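(* Let $\mathcal{C}\subseteq\mathcal{P}(\mathbb{R}^n)$, let $\mathcal{T}$ be a $\mathcal{C}$-consistent branching tree, and let $\epsilon>0$. Then $\succeq_{\epsilon,\mathcal{T}}$ defines a preorder (a reflexive and transitive relation) and $\succ_{\epsilon,\mathcal{T}}$ defines a strict order (an irreflexive, antisymmetric and transitive relation) on $\bigcap\mathcal{C}$.
   Context: For $\mathcal{C}\subseteq\mathcal{P}(\mathbb{R}^n)$ (power set) write $\bigcap\mathcal{C}=\bigcap_{C\in\mathcal{C}}C$, with $\bigcap\emptyset=\mathbb{R}^n$. For a list $\tau=(i_1,\dots,i_k)\in\{\pm1,\dots,\pm n\}^k$ write $\tau(x)=(\mathrm{sgn}(i_1)x_{|i_1|},\dots,\mathrm{sgn}(i_k)x_{|i_k|})\in\mathbb{R}^k$ for $x\in\mathbb{R}^n$ and $\tau(C)=\{\tau(x):x\in C\}$ for $C\subseteq\mathbb{R}^n$; the empty list is allowed. For another list $\tau'=(i'_1,\dots,i'_{k'})$, write $\tau\trianglelefteq\tau'$ if $k\le k'$ and $i_j=i'_j$ for all $1\le j\le k$. For a node $v$ of a directed graph, $\delta^+(v)$ is its set of children. Branching tree: a tuple $\mathcal{T}=(V,E,B,\sigma)$ is a $\mathcal{C}$-consistent branching tree if: (T1) $(V,E)$ is an arborescence with $1\le|V|<\infty$ and root $r\in V$. (T2) Each $v\in V$ has a branching constraint $B_v\subseteq\mathbb{R}^n$, and $B_r=\mathbb{R}^n$. (T3) For all $u\in V$ with $\delta^+(u)\ne\emptyset$: $\bigcap\mathcal{C}\subseteq\bigcup_{v\in\delta^+(u)}B_v$.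 (T4) Each $v\in V$ has a list $\sigma_v\in\{\pm1,\dots,\pm n\}^{\ell_v}$, $\ell_v\in\{0,\dots,n\}$, with $|(\sigma_v)_1|,\dots,|(\sigma_v)_{\ell_v}|$ pairwise distinct. (T5) $\sigma_u\trianglelefteq\sigma_v$ for all $u\in V$, $v\in\delta^+(u)$. (T6) For all $v\in V$ and $1\le i\le\ell_v$: $\max\{\sigma_v(x)_i:x\in\bigcap\mathcal{C}\}<\infty$ (i.e. the set is bounded above). (T7) For all $u\in V$ and $v\ne w$ in $\delta^+(u)$: $\sigma_u(B_v)\cap\sigma_u(B_w)=\emptyset$. Relations: for $v\in V$ let $\mathcal{B}_v=\{B_u: u \text{ is a node on the } r\text{-}v\text{-path in } \mathcal{T}\}$. For $x,y\in\bigcap\mathcal{C}$ let $\mathrm{dcn}(x,y)$ be the deepest node $w\in V$ with $x,y\in\bigcap(\mathcal{C}\cup\mathcal{B}_w)$. For $\epsilon>0$ and $a,b\in\mathbb{R}^k$, let $a\succ_\epsilon b$ mean $a\neq b$ and $a_i\ge b_i+\epsilon$ for the smallest index $i$ with $a_i\ne b_i$. For $x,y\in\bigcap\mathcal{C}$ and $v=\mathrm{dcn}(x,y)$: $x\succeq_{\epsilon,\mathcal{T}}y$ iff $\sigma_v(x)=\sigma_v(y)$ or $\sigma_v(x)\succ_\epsilon\sigma_v(y)$; $x\succ_{\epsilon,\mathcal{T}}y$ iff $\sigma_v(x)\succ_\epsilon\sigma_v(y)$. *)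

(* Defs.v *)
From HB Require Import structures.
From mathcomp Require Import all_boot all_order all_algebra.
From mathcomp Require Import boolp classical_sets reals.

Set Implicit Arguments.
Unset Strict Implicit.
Unset Printing Implicit Defensive.

Import Order.TTheory GRing.Theory Num.Theory.

Local Open Scope classical_set_scope.
Local Open Scope ring_scope.

(* The signed index s * (i + 1), with 0 <= i < n, is encoded as the pair (b, i)
   where b = false for s = 1 and b = true for s = -1. *)
Definition sindex (n : nat) : Type := (bool * 'I_n)%type.

Definition sapply (R : realType) (n : nat) (tau : seq (sindex n))
    (x : 'rV[R]_n) : 'rV[R]_(size tau) :=
  \row_(j < size tau)
    let: (b, i) := tnth (in_tuple tau) j in (-1) ^+ b * x 0 i.

Record branching_tree (R : realType) (n : nat) := BranchingTree {
  node : finType;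
  edge : rel node;
  root : node;
  constr : node -> set 'rV[R]_n;
  sigma : node -> seq (sindex n) }.

Section Tree.
Variables (R : realType) (n : nat) (T : branching_tree R n).

Definition children (u : node T) : set (node T) := [set v | edge u v].

(* A walk from the root is given by the list of its nodes after the root. *)
Definition root_walk (v : node T) (p : seq (node T)) : Prop :=
  path (@edge R n T) (root T) p /\ last (root T) p = v.

(* Quantifying over all walks, v = root T included, excludes cycles, loops and
   edges entering the root. *)
Definition arborescence : Prop := forall v : node T, exists! p, root_walk v p.

(* The nodes after the root on the path from the root to v (in an arborescence
   this walk exists and is unique). *)
Definition root_path (v : node T) : seq (node T) :=
  xget [::] [set p | root_walk v p].

Definition depth (v : node T) : nat := size (root_path v).

Definition path_constrs (v : node T) : set (set 'rV[R]_n) :=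
  [set constr u | u in [set u : node T | u \in root T :: root_path v]].

Variable C : set (set 'rV[R]_n).

Record consistent : Prop := Consistent {
  consistent_arborescence : arborescence;
  consistent_root : constr (root T) = setT;
  consistent_cover : forall u : node T, children u !=set0 ->
    \bigcap_(A in C) A `<=` \bigcup_(v in children u) constr v;
  consistent_size : forall v : node T, (size (sigma v) <= n)%N;
  consistent_uniq : forall v : node T, uniq [seq t.2 | t <- sigma v];
  consistent_prefix : forall u v : node T,
    children u v -> prefix (sigma u) (sigma v);
  consistent_bounded : forall (v : node T) (i : 'I_(size (sigma v))),
    has_ubound [set sapply (sigma v) x 0 i | x in \bigcap_(A in C) A];
  consistent_disjoint : forall u v w : node T,
    children u v -> children u w -> v <> w ->
    (sapply (sigma u) @` constr v) `&` (sapply (sigma u) @` constr w) = set0 }.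

Definition common_node (x y : 'rV[R]_n) (w : node T) : Prop :=
  (\bigcap_(A in C `|` path_constrs w) A) x /\
  (\bigcap_(A in C `|` path_constrs w) A) y.

(* If T is consistent with C and x, y lie in the intersection of C, then the
   root is a common node and the maximizer is unique. *)
Definition dcn (x y : 'rV[R]_n) : node T :=
  [arg max_(w > root T | `[< common_node x y w >]) depth w].

End Tree.

Definition eps_gt (R : realType) (k : nat) (e : R) (a b : 'rV[R]_k) : Prop :=
  a <> b /\
  exists i : 'I_k, [/\ forall j : 'I_k, (j < i)%N -> a 0 j = b 0 j,
                       a 0 i <> b 0 i & b 0 i + e <= a 0 i].

Definition tree_gt (R : realType) (n : nat) (C : set (set 'rV[R]_n))
    (T : branching_tree R n) (e : R) (x y : 'rV[R]_n) : Prop :=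
  let v := dcn T C x y in eps_gt e (sapply (sigma v) x) (sapply (sigma v) y).

Definition tree_ge (R : realType) (n : nat) (C : set (set 'rV[R]_n))
    (T : branching_tree R n) (e : R) (x y : 'rV[R]_n) : Prop :=
  let v := dcn T C x y in
  sapply (sigma v) x = sapply (sigma v) y \/
  eps_gt e (sapply (sigma v) x) (sapply (sigma v) y).

Definition preorder_on (X : Type) (D : set X) (r : X -> X -> Prop) : Prop :=
  (forall x, D x -> r x x) /\
  (forall x y z, D x -> D y -> D z -> r x y -> r y z -> r x z).

Definition strict_order_on (X : Type) (D : set X) (r : X -> X -> Prop) : Prop :=
  [/\ forall x, D x -> ~ r x x,
      forall x y, D x -> D y -> r x y -> r y x -> x = y &
      forall x y z, D x -> D y -> D z -> r x y -> r y z -> r x z].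

(* Main.v *)
Require Import Defs.
From HB Require Import structures.
From mathcomp Require Import all_boot all_order all_algebra.
From mathcomp Require Import boolp classical_sets reals.

Set Implicit Arguments.
Unset Strict Implicit.
Unset Printing Implicit Defensive.

Import Order.TTheory GRing.Theory Num.Theory.

Local Open Scope classical_set_scope.
Local Open Scope ring_scope.

(** The nodes whose path constraints all hold at a point [x] form a chain from
    the root, because the constraints of two siblings are disjoint
    ([holds_chain]); [dcn x y] is the largest common element of the chains of
    [x] and [y] ([dcnP]). Comparing at a deeper node refines the comparison:
    a strict comparison at a node persists at its descendants, and a weak one
    is inherited by its ancestors ([eps_gt_prefix], [lexge_prefix]). Moreover,
    when [dcn x y] lies strictly above a node of the chain of [y], the two
    points leave it through different children, so their images under the list
    of [dcn x y] differ and a weak comparison of them is strict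
    ([dcn_separates]).

    For transitivity of the weak relation, [dcn x y] and [dcn y z] both lie in
    the chain of [y]; let [m] be the upper one. It is common to the three
    points, and [x >= y >= z] holds at [m], hence [x >= z] holds at [m]. Either
    [dcn x z] is [m], or it is strictly below; in the latter case one of the
    two comparisons at [m] is strict by separation, so [x > z] holds at [m] and
    therefore at [dcn x z].

    Since [dcn] is symmetric and [eps_gt] asymmetric, the strict relation is
    the strict part of the weak one, and the strict part of a preorder is a
    strict order. *)

(** * The lexicographic comparison of vectors *)

Section Lexicographic.
Variables (R : realType) (e : R).
Hypothesis e_gt0 : 0 < e.

Definition lexge (k : nat) (a b : 'rV[R]_k) : Prop := a = b \/ eps_gt e a b.

Lemma eps_gt_trans (k : nat) (a b c : 'rV[R]_k) :
  eps_gt e a b -> eps_gt e b c -> eps_gt e a c.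
Proof.
move=> [_ [i [abE abN ab]]] [_ [j [bcE bcN bc]]].
suff [l [acE acl]] : exists l : 'I_k,
    (forall m : 'I_k, (m < l)%N -> a 0 m = c 0 m) /\ c 0 l + e <= a 0 l.
  have acN : a 0 l <> c 0 l.
    by move=> E; move: acl; rewrite E gerDl leNgt e_gt0.
  by split; [move=> E; apply: acN; rewrite E | exists l].
case: (ltngtP i j) => [ij|ji|/val_inj ij].
- exists i; split; last by rewrite -bcE.
  by move=> m mi; rewrite abE // bcE // (ltn_trans mi).
- exists j; split; last by rewrite abE.
  by move=> m mj; rewrite abE ?bcE // (ltn_trans mj).
- rewrite -{}ij in bcE bc *; exists i; split.
    by move=> m mi; rewrite abE ?bcE.
  by apply: le_trans bc _; apply: le_trans ab; rewrite lerDl ltW.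
Qed.

Lemma eps_gt_lexge_trans (k : nat) (a b c : 'rV[R]_k) :
  eps_gt e a b -> lexge b c -> eps_gt e a c.
Proof. by move=> ab [<- //|]; exact: eps_gt_trans. Qed.

Lemma lexge_eps_gt_trans (k : nat) (a b c : 'rV[R]_k) :
  lexge a b -> eps_gt e b c -> eps_gt e a c.
Proof. by move=> [-> //|]; exact: eps_gt_trans. Qed.

Lemma lexge_trans (k : nat) (a b c : 'rV[R]_k) :
  lexge a b -> lexge b c -> lexge a c.
Proof. by move=> [-> //|ab bc]; right; exact: eps_gt_lexge_trans bc. Qed.

Lemma eps_gt_asym (k : nat) (a b : 'rV[R]_k) :
  eps_gt e a b -> ~ lexge b a.
Proof. by move=> ab ba; have [/(_ erefl)] := eps_gt_lexge_trans ab ba. Qed.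

End Lexicographic.

Section Prefix.
Variables (R : realType) (n : nat) (e : R).
Implicit Types (s t : seq (sindex n)) (x y : 'rV[R]_n).

Lemma sapply_cat s t x (i : 'I_(size s)) (j : 'I_(size (s ++ t))) :
  i = j :> nat -> sapply (s ++ t) x 0 j = sapply s x 0 i.
Proof.
have t0 := tnth (in_tuple s) i.
move=> ij; rewrite !mxE !(tnth_nth t0) /= -ij nth_cat.
by rewrite ltn_ord.
Qed.

Lemma eps_gt_prefix s t x y : prefix s t ->
  eps_gt e (sapply s x) (sapply s y) -> eps_gt e (sapply t x) (sapply t y).
Proof.
move=> /prefixP[u ->] [_ [i [xyE xyN xy]]].
have si : (i < size (s ++ u))%N by rewrite size_cat ltn_addr.
have xyN' : sapply (s ++ u) x 0 (Ordinal si) <> sapply (s ++ u) y 0 (Ordinal si).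
  by rewrite !(@sapply_cat _ _ _ i).
split; first by move=> E; apply: xyN'; rewrite E.
exists (Ordinal si); split => //; last by rewrite !(@sapply_cat _ _ _ i).
move=> j /= ji; have js := ltn_trans ji (ltn_ord i).
by rewrite !(@sapply_cat _ _ _ (Ordinal js)) // xyE.
Qed.

(** The first difference of the longer vectors may lie within the prefix, and
    then it is also the one of the shorter vectors. If it lies
    beyond the prefix, the prefixes coincide. *)
Lemma lexge_prefix s t x y : prefix s t ->
  lexge e (sapply t x) (sapply t y) -> lexge e (sapply s x) (sapply s y).
Proof.
move=> /prefixP[u ->].
have st (j : 'I_(size s)) : (j < size (s ++ u))%N by rewrite size_cat ltn_addr.
have coordE (z : 'rV[R]_n) j : sapply s z 0 j = sapply (s ++ u) z 0 (Ordinal (st j)).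
  by rewrite (@sapply_cat _ _ _ j).
case=> [E|[_ [i [xyE xyN xy]]]].
  by left; apply/rowP => j; rewrite !coordE E.
have [si|is_] := leqP (size s) i.
  left; apply/rowP => j; rewrite !coordE xyE //=.
  exact: leq_trans (ltn_ord j) si.
have iE : i = Ordinal (st (Ordinal is_)) by exact: val_inj.
rewrite {}iE in xyE xyN xy; right; split.
  by move=> E; apply: xyN; rewrite -!coordE E.
exists (Ordinal is_); rewrite !coordE; split=> // j ji.
by rewrite !coordE xyE.
Qed.

End Prefix.

(** * Chains of nodes in a consistent tree *)

Section Chains.
Variables (R : realType) (n : nat) (C : set (set 'rV[R]_n)).
Variable T : branching_tree R n.
Hypothesis hT : consistent T C.
Implicit Types (u v w c d : node T) (p q : seq (node T)) (x y z : 'rV[R]_n).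

Local Notation X := (\bigcap_(A in C) A).

Definition holds x v : Prop :=
  forall u, u \in Defs.root T :: root_path v -> constr u x.

Definition above v w : Prop := prefix (root_path v) (root_path w).

Lemma root_pathP v : root_walk v (root_path v).
Proof.
rewrite /root_path; case: xgetP => [p -> //|noP].
by have [p [/noP]] := consistent_arborescence hT v.
Qed.

Lemma root_path_last p : path (@edge R n T) (Defs.root T) p ->
  root_path (last (Defs.root T) p) = p.
Proof.
move=> rp; have [q [_ qU]] := consistent_arborescence hT (last (Defs.root T) p).
by rewrite -(qU _ (root_pathP _)) (qU p).
Qed.

Lemma above_depth_eq v w : above v w -> (depth w <= depth v)%N -> w = v.
Proof.
move=> /prefixP[q wE]; rewrite /depth wE size_cat -{2}[size _]addn0 leq_add2l.
rewrite leqn0 size_eq0 => /eqP q0; rewrite q0 cats0 in wE.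
have [_ wl] := root_pathP w; have [_ vl] := root_pathP v.
by rewrite -wl wE vl.
Qed.

(** The part of the walk to [w] that follows [v]. *)
Lemma above_walk v w : above v w -> exists q,
  [/\ root_path w = root_path v ++ q, path (@edge R n T) v q & last v q = w].
Proof.
move=> /prefixP[q wE]; exists q; have [] := root_pathP w.
have [_ vE] := root_pathP v.
by rewrite wE cat_path last_cat vE => /andP[].
Qed.

Lemma sigma_above v w : above v w -> prefix (sigma v) (sigma w).
Proof.
move=> /above_walk[q [_ vq <-]].
elim: q v vq => [v _|c q IH v /=]; first exact: prefix_refl.
move=> /andP[vc /IH]; apply: prefix_trans.
exact: (consistent_prefix hT).
Qed.

Lemma holds_above x v w : above v w -> holds x w -> holds x v.
Proof.
move=> /prefixP[q wE] xw u uv; apply: xw.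
by rewrite wE -cat_cons mem_cat uv.
Qed.

Lemma children_disjoint u v w x y : children u v -> children u w ->
  constr v x -> constr w y -> sapply (sigma u) x = sapply (sigma u) y -> v = w.
Proof.
move=> uv uw vx wy xyE; apply: contrapT => vw.
suff : (set0 : set 'rV[R]_(size (sigma u))) (sapply (sigma u) x) by [].
rewrite -(consistent_disjoint hT uv uw vw).
by split; [exists x | exists y].
Qed.

(** At the first place where two walks diverge they would enter two siblings,
    whose constraints have no common point. *)
Lemma walks_comparable x v p q :
  path (@edge R n T) v p -> path (@edge R n T) v q ->
  {in p, forall u, constr u x} -> {in q, forall u, constr u x} ->
  prefix p q \/ prefix q p.
Proof.
elim: p v q => [|c p IH] v [|d q] /=; try by auto.
move=> /andP[vc cp] /andP[vd dq] xp xq.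
have cd : c = d.
  by apply: (children_disjoint vc vd (xp _ _) (xq _ _) erefl); rewrite mem_head.
rewrite {}cd eqxx /= in cp *; apply: IH cp dq _ _ => u up.
- by apply: xp; rewrite inE up orbT.
- by apply: xq; rewrite inE up orbT.
Qed.

Lemma holds_chain x v w : holds x v -> holds x w -> above v w \/ above w v.
Proof.
move=> xv xw; have [vp _] := root_pathP v; have [wp _] := root_pathP w.
apply: (walks_comparable vp wp) => u up.
- by apply: xv; rewrite inE up orbT.
- by apply: xw; rewrite inE up orbT.
Qed.

Lemma common_nodeE x y w : X x -> X y ->
  common_node C x y w <-> holds x w /\ holds y w.
Proof.
suff one z : X z ->
    (\bigcap_(A in C `|` path_constrs w) A) z <-> holds z w.
  by move=> /one xE /one yE; split=> -[/xE xw /yE yw].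
move=> zX; split=> [zw u uw|zw A [AC|[u uw <-]]]; last exact: zw.
- by apply: zw; right; exists u.
- exact: zX.
Qed.

Lemma holds_root x : holds x (Defs.root T).
Proof.
by move=> u; rewrite (root_path_last (p := [::])) // inE => /eqP->;
  rewrite (consistent_root hT).
Qed.

(** Depth is maximized over the common nodes, which form a chain, so that the
    deepest one lies below all the others. *)
Lemma dcnP x y : X x -> X y ->
  [/\ holds x (dcn T C x y), holds y (dcn T C x y) &
      forall w, holds x w -> holds y w -> above w (dcn T C x y)].
Proof.
move=> xX yX; rewrite /dcn; case: arg_maxnP => [|v /asboolP].
  by apply/asboolP/common_nodeE => //; split; exact: holds_root.
move=> /(common_nodeE _ xX yX)[xv yv] vmax; split=> // w xw yw.
have wv : (depth w <= depth v)%N.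
  by apply: vmax; apply/asboolP/common_nodeE.
case: (holds_chain xv xw) => // vw.
by rewrite (above_depth_eq vw wv); exact: prefix_refl.
Qed.

Lemma dcnC x y : dcn T C x y = dcn T C y x.
Proof.
rewrite /dcn; congr (@arg_max _ _ _ _).
by apply/funext => w; congr asbool; apply/propext; split=> -[].
Qed.

(** Below [dcn x y], the point [y] continues through some child. By the
    covering condition [x] also lies in some child, which is another one by
    maximality of [dcn x y]. The constraints of these two children have disjoint
    images under the list of [dcn x y]. *)
Lemma dcn_separates x y w : X x -> X y -> holds y w ->
  above (dcn T C x y) w -> w <> dcn T C x y ->
  sapply (sigma (dcn T C x y)) x <> sapply (sigma (dcn T C x y)) y.
Proof.
move=> xX yX yw.
move: (dcn T C x y) (dcnP xX yX) => v [xv yv vmax] vw wv xyE.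
have [[|c q] [wE /= vq vqE]] := above_walk vw; first exact: wv.
have [vc _] := andP vq.
have yc : constr c y.
  by apply: yw; rewrite wE inE mem_cat mem_head !orbT.
have [d vd xd] : (\bigcup_(d in children v) constr d) x.
  by apply: (consistent_cover hT) xX; exists c.
have dc : d = c := children_disjoint vd vc xd yc xyE.
rewrite {}dc in xd {vd}.
have cE : root_path c = rcons (root_path v) c.
  have [vp vE] := root_pathP v.
  rewrite -[in LHS](last_rcons (Defs.root T) (root_path v) c) root_path_last //.
  by rewrite rcons_path vp vE.
have holds_c z : holds z v -> constr c z -> holds z c.
  move=> zv zc u; rewrite cE -rcons_cons mem_rcons inE.
  by case/predU1P => [-> //|]; exact: zv.
(* So [c] is common to both points, yet deeper than [v]. *)
have /prefixP[r] := vmax c (holds_c _ xv xd) (holds_c _ yv yc).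
move=> /(congr1 size); rewrite cE size_cat size_rcons => /eqP.
by rewrite addSnnS -{1}[size _]addn0 eqn_add2l.
Qed.

(** * The relations of the tree *)

Variable e : R.
Hypothesis e_gt0 : 0 < e.

Lemma tree_geE x y : tree_ge C T e x y =
  lexge e (sapply (sigma (dcn T C x y)) x) (sapply (sigma (dcn T C x y)) y).
Proof. by []. Qed.

Lemma tree_ge_refl x : tree_ge C T e x x.
Proof. by left. Qed.

Lemma tree_ge_trans x y z : X x -> X y -> X z ->
  tree_ge C T e x y -> tree_ge C T e y z -> tree_ge C T e x z.
Proof.
move=> xX yX zX; rewrite !tree_geE => xy yz.
have [xv yv vmax] := dcnP xX yX; have [yw zw wmax] := dcnP yX zX.
have [xu zu umax] := dcnP xX zX.
case: (holds_chain yv yw) => [vw|wv].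
(* [dcn x y] is the upper node; if [dcn x z] is another one, then [x] and [z]
   go on below [dcn x y] without [y], so that [x] and [y] differ there. *)
- have vu := umax _ xv (holds_above vw zw).
  have yz_v := lexge_prefix (sigma_above vw) yz.
  have [-> |uv] := EM (dcn T C x z = dcn T C x y).
    exact: (lexge_trans e_gt0 xy yz_v).
  right; apply: (eps_gt_prefix (sigma_above vu)).
  apply: (eps_gt_lexge_trans e_gt0 _ yz_v); case: xy => // xyE; exfalso.
  move: vu uv xyE; rewrite (dcnC x y) => vu uv xyE.
  exact: (dcn_separates yX xX xu vu uv).
(* [dcn y z] is the upper node; if [dcn x z] is another one, then [x] and [z]
   go on below [dcn y z] without [y], so that [y] and [z] differ there. *)
- have wu := umax _ (holds_above wv xv) zw.
  have xy_w := lexge_prefix (sigma_above wv) xy.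
  have [-> |uw] := EM (dcn T C x z = dcn T C y z).
    exact: (lexge_trans e_gt0 xy_w yz).
  right; apply: (eps_gt_prefix (sigma_above wu)).
  apply: (lexge_eps_gt_trans e_gt0 xy_w); case: yz => // yzE; exfalso.
  exact: (dcn_separates yX zX zu wu uw).
Qed.

Lemma tree_gtE x y :
  tree_gt C T e x y <-> tree_ge C T e x y /\ ~ tree_ge C T e y x.
Proof.
rewrite !tree_geE (dcnC y x); split=> [xy|[[xyE|//] yx]].
- by split; [right | exact: (eps_gt_asym e_gt0 xy)].
- by case: yx; left.
Qed.

End Chains.

Theorem lemma3 (R : realType) (n : nat) (C : set (set 'rV[R]_n))
    (T : branching_tree R n) (hT : consistent T C) (e : R) (he : 0 < e) :
  preorder_on (\bigcap_(A in C) A) (tree_ge C T e) /\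
  strict_order_on (\bigcap_(A in C) A) (tree_gt C T e).
Proof.
have ge_trans := tree_ge_trans hT he.
split; split.
- by move=> x _; exact: tree_ge_refl.
- exact: ge_trans.
- by move=> x _ /(tree_gtE _ _ he)[].
- by move=> x y _ _ /(tree_gtE _ _ he)[_ yx] /(tree_gtE _ _ he)[].
- move=> x y z xX yX zX /(tree_gtE _ _ he)[xy yx] /(tree_gtE _ _ he)[yz _].
  apply/(tree_gtE _ _ he); split; first exact: ge_trans yz.
  by move=> zx; apply: yx; exact: ge_trans zx.
Qed.
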